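(* Let $\lambda=\lambda^{<\lambda}$ be an infinite regular cardinal. Consider the statements: (1) There exists a $\lambda^+$-Luzin subset of ${}^{\lambda}\lambda$; (2) There exists a tight strongly unbounded coloring $c:\lambda\times\lambda^+\rightarrow\lambda$; (3) For every partition $\mathcal S$ of $E^{\lambda^+}_{\lambda}=\{\alpha<\lambda^+\mid \mathrm{cf}(\alpha)=\lambda\}$ into stationary sets, $\clubsuit_{\mathrm{ad}}(\mathcal S,\lambda,{<}\lambda)$ holds. Then (1) implies (2), and (2) implies (3).
   Context: For a set $\mathbb T\subseteq{}^{<\lambda}\lambda$ and $t\in{}^{<\lambda}\lambda$, ''$t\subseteq f$'' means $f$ extends $t$. A $\kappa$-Luzin subset of ${}^\lambda\lambda$ is a set $L\subseteq{}^\lambda\lambda$ of size $\kappa$ such that for every $B\in[L]^\kappa$ there is $t\in{}^{<\lambda}\lambda$ such that for every $t'\in{}^{<\lambda}\lambda$ extending $t$ there is an element of $B$ extending $t'$. For a regular uncountable cardinal $\kappa$, infinite cardinals $\nu,\lambda<\kappa$ and a coloring $c:\nu\times\kappa\rightarrow\lambda$: for $\beta<\kappa$ let $c_\beta:\nu\to\lambda$ be $c_\beta(\eta):=c(\eta,\beta)$. $c$ is strongly unbounded iff for every cofinal $B\subseteq\kappa$ there are $\eta<\nu$ and $t:\eta\to\lambda$ with $\sup\{c_\beta(\eta)\mid \beta\in B,\ t\subseteq c_\beta\}=\lambda$. For $\mathbb T\subseteq{}^{<\nu}\lambda$ let $[\mathbb T]_c:=\{\beta<\kappa\mid \forall\eta<\nu\,(c_\beta\restriction\eta\in\mathbb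 T)\}$, and $\mathcal T_c:=\{\mathbb T\subseteq{}^{<\nu}\lambda\mid \sup([\mathbb T]_c)=\kappa\}$. $c$ is tight iff $\mathrm{cf}(\mathcal T_c,\supseteq)\le\kappa$, where $\mathrm{cf}(\mathcal T_c,\supseteq)$ is the least size of a family $\mathcal D\subseteq\mathcal T_c$ such that every $\mathbb T\in\mathcal T_c$ contains some member of $\mathcal D$. For a regular uncountable $\kappa$, a collection $\mathcal S$ of stationary subsets of $\kappa$ and nonzero cardinals $\mu,\theta<\kappa$, $\clubsuit_{\mathrm{ad}}(\mathcal S,\mu,{<}\theta)$ asserts the existence of $\langle\mathcal A_\alpha\mid\alpha\in\bigcup\mathcal S\rangle$ such that: (i) for every limit ordinal $\alpha\in\bigcup\mathcal S$, $\mathcal A_\alpha$ is a pairwise disjoint family of $\mu$ many cofinal subsets of $\alpha$; (ii) for every $\mathcal B\subseteq[\kappa]^\kappa$ of size $<\theta$ and every $S\in\mathcal S$, there are stationarily many $\alpha\in S$ with $\sup(A\cap B)=\alpha$ for all $A\in\mathcal A_\alpha$, $B\in\mathcal B$; (iii) for all distinct $A,A'$ from $\bigcup_{S\in\mathcal S}\bigcup_{\alpha\in S}\mathcal A_\alpha$, $\sup(A\cap A')<\sup(A)$. *)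

(* Defs.v *)
From HB Require Import structures.
From mathcomp Require Import all_boot all_order.
From mathcomp Require Import all_classical.
From mathcomp Require wochoice.

Set Implicit Arguments.
Unset Strict Implicit.
Unset Printing Implicit Defensive.

Import Order.TTheory.

Local Open Scope order_scope.
Local Open Scope classical_set_scope.
Local Open Scope card_scope.

(* Ordinals are represented by well-ordered types: the elements of a
   well-ordered type [K] are the ordinals below (the ordinal represented by)
   [K], and cardinals are represented by initial ordinals. *)

Definition card_lt (T U : Type) (A : set T) (B : set U) : Prop :=
  A #<= B /\ ~ (B #<= A).

Definition below (d : Order.disp_t) (K : orderType d) (a : K) : set K :=
  [set x | x < a].

Definition is_cardinal (d : Order.disp_t) (K : orderType d) : Prop :=
  wochoice.well_order (<=%O : rel K) /\ forall a : K, card_lt (below a) [set: K].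

Definition is_infinite_cardinal (d : Order.disp_t) (K : orderType d) : Prop :=
  is_cardinal K /\ infinite_set [set: K].

(* Every cardinal below [K] is the cardinality of a subset of [K], so the last
   clause says that [K] is the least cardinal above [L]. *)
Definition is_succ_cardinal (d d' : Order.disp_t)
    (L : orderType d) (K : orderType d') : Prop :=
  [/\ is_cardinal K, card_lt [set: L] [set: K] &
      forall A : set K, card_lt A [set: K] -> A #<= [set: L]].

(* [sup A = K] for [A] a set of ordinals below [K]. *)
Definition unbounded (d : Order.disp_t) (K : orderType d) (A : set K) : Prop :=
  forall x : K, exists2 y, A y & x < y.

(* Both forms below use the weak inequality, so that they also give the right
   notion of cofinality at successor ordinals. *)
Definition cofinal (d : Order.disp_t) (K : orderType d) (A : set K) : Prop :=
  forall x : K, exists2 y, A y & x <= y.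

Definition cofinal_below (d : Order.disp_t) (K : orderType d)
    (A : set K) (a : K) : Prop :=
  A `<=` below a /\ forall x, x < a -> exists2 y, A y & x <= y.

(* cf(L) = L *)
Definition is_regular (d : Order.disp_t) (L : orderType d) : Prop :=
  (exists2 A : set L, cofinal A & A #= [set: L]) /\
  forall A : set L, cofinal A -> [set: L] #<= A.

(* cf(a) = L, for [a] an ordinal below [K] *)
Definition cofinality_is (d d' : Order.disp_t)
    (L : orderType d) (K : orderType d') (a : K) : Prop :=
  (exists2 A : set K, cofinal_below A a & A #= [set: L]) /\
  forall A : set K, cofinal_below A a -> [set: L] #<= A.

Definition E_cof (d d' : Order.disp_t) (L : orderType d) (K : orderType d') :
    set K :=
  [set a | cofinality_is L a].
Arguments E_cof {d d'} L K.

Definition limit_ordinal (d : Order.disp_t) (K : orderType d) (a : K) : Prop :=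
  (exists x, x < a) /\ forall x, x < a -> exists2 y, x < y & y < a.

Definition is_club (d : Order.disp_t) (K : orderType d) (C : set K) : Prop :=
  unbounded C /\
  forall a, limit_ordinal a -> supremums (C `&` below a) a -> C a.

Definition stationary (d : Order.disp_t) (K : orderType d) (S : set K) : Prop :=
  forall C : set K, is_club C -> S `&` C !=set0.

(* The functions from an ordinal below [N] to [L], i.e. ${}^{<N}L$. *)
Record pfun (d d' : Order.disp_t) (N : orderType d) (L : orderType d') :=
  Pfun { pdom : N ; pval : {x : N | x < pdom} -> L }.

Definition prestrict (d d' : Order.disp_t) (N : orderType d) (L : orderType d')
    (f : N -> L) (a : N) : pfun N L :=
  Pfun (fun x : {x : N | x < a} => f (sval x)).

(* $t\subseteq f$ for a total function [f] *)
Definition extended_by (d d' : Order.disp_t) (N : orderType d)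
    (L : orderType d') (t : pfun N L) (f : N -> L) : Prop :=
  forall x : {x : N | x < pdom t}, pval x = f (sval x).

(* $t\subseteq t'$ for partial functions *)
Definition pextended_by (d d' : Order.disp_t) (N : orderType d)
    (L : orderType d') (t t' : pfun N L) : Prop :=
  forall x : {x : N | x < pdom t},
    exists2 x' : {x : N | x < pdom t'}, sval x' = sval x & pval x' = pval x.

Definition is_luzin (d d' : Order.disp_t) (L : orderType d) (K : orderType d')
    (X : set (L -> L)) : Prop :=
  X #= [set: K] /\
  forall B : set (L -> L), B `<=` X -> B #= [set: K] ->
    exists t : pfun L L, forall t' : pfun L L, pextended_by t t' ->
      exists2 f, B f & extended_by t' f.

Section Colorings.
Variables (dN dK dL : Order.disp_t).
Variables (N : orderType dN) (K : orderType dK) (L : orderType dL).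
Variable c : N -> K -> L.

Definition strongly_unbounded : Prop :=
  forall B : set K, cofinal B ->
    exists t : pfun N L,
      unbounded [set c (pdom t) b | b in [set b | B b /\ extended_by t (c^~ b)]].

Definition branches (T : set (pfun N L)) : set K :=
  [set b | forall a : N, T (prestrict (c^~ b) a)].

Definition large_trees : set (set (pfun N L)) :=
  [set T | unbounded (branches T)].

(* cf(large_trees, superset) <= K *)
Definition tight : Prop :=
  exists D : set (set (pfun N L)),
    [/\ D `<=` large_trees,
        forall T, large_trees T -> exists2 T', D T' & T' `<=` T &
        D #<= [set: K]].

End Colorings.

(* [A] is only relevant on the union of [S]; [M] and [Th] represent the
   cardinals mu and theta. *)
Definition club_ad (dK dM dTh : Order.disp_t) (K : orderType dK)
    (S : set (set K)) (M : orderType dM) (Th : orderType dTh) : Prop :=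
  exists A : K -> set (set K),
    [/\ forall a, (\bigcup_(X in S) X) a -> limit_ordinal a ->
          [/\ trivIset (A a) id, A a #= [set: M] &
              forall Y, A a Y -> cofinal_below Y a],
        forall B : set (set K), (forall Z, B Z -> Z #= [set: K]) ->
          card_lt B [set: Th] ->
          forall X, S X ->
            stationary [set a | X a /\
              forall Y Z, A a Y -> B Z -> supremums (Y `&` Z) a] &
        forall Y Y', (\bigcup_(X in S) \bigcup_(a in X) A a) Y ->
          (\bigcup_(X in S) \bigcup_(a in X) A a) Y' -> Y <> Y' ->
          exists s s', [/\ supremums (Y `&` Y') s, supremums Y s' & s < s']].

(* Main.v *)
Require Import Defs.
From mathcomp Require Import all_boot all_order.
From mathcomp Require Import all_classical.

Set Implicit Arguments.
Unset Strict Implicit.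
Unset Printing Implicit Defensive.

Import Order.TTheory.

Local Open Scope order_scope.
Local Open Scope classical_set_scope.
Local Open Scope card_scope.

(* Write c_b for the function c^~ b.

   A Luzin set is enumerated as the family of all c_b.  A large tree then contains
   all sequences compatible with some fixed t, so these L many trees witness
   tightness.

   For the second implication, fix a dense family of at most K large trees.  For an
   unbounded set Z, the sequences extended by c_b for unboundedly many b in Z form a
   large tree, which therefore contains a tree T of the family.  By Ulam's theorem
   every stationary set splits into K stationary sets, and there are only K lists of
   fewer than L trees, so each a of cofinality L can be assigned such a list in such
   a way that every list occurs stationarily often.  For each tree on the list of a,
   pick branches y = c_g with g >= a, all of them distinct, and consider, as in
   Todorcevic's constructions from an unbounded family, the points b < a with
   E a b <= y n, where n is the first place at which c_b and y differ and E a is an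
   L-valued function on a tending to L at every a' <= a of cofinality L.  Two such
   sets for distinct branches are almost disjoint.  If the set of a missed Z above
   some point below a for stationarily many a, pressing down would freeze that point
   and the values of E a on an interval in which Z realizes all of T; strong
   unboundedness applied to the corresponding branches then yields an a with y n
   large, and an element of Z near y.

   Adding to these sets the pieces of a ladder at a makes them cofinal in a
   unconditionally; this preserves almost disjointness because the functions c_b
   along the ladder have at most one limit point, which the branches avoid. *)

Lemma set_choice (I Y : Type) (y0 : Y) (A : set I) (P : I -> Y -> Prop) :
  (forall i, A i -> exists y, P i y) ->
  exists f : I -> Y, forall i, A i -> P i (f i).
Proof.
move=> AP; have /choice[f fP] i : exists y, A i -> P i y; last by exists f.
by have [/AP[y]|] := pselect (A i); [exists y|exists y0].
Qed.

Section Cardinality.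
Variables T U : Type.
Implicit Types (A : set T) (B : set U).

Lemma set_inj_card_le A B (f : T -> U) : set_fun A B f -> set_inj A f -> A #<= B.
Proof.
move=> fAB f_inj; have [g] : $|{injfun A >-> B}| by apply/injfunPex; exists f.
exact: inj_card_le.
Qed.

Lemma card_le_set_inj (u0 : U) A B : A #<= B ->
  exists2 f : T -> U, set_fun A B f & set_inj A f.
Proof.
elim/Ppointed: U u0 B => [V v|V _ B]; first by have := no v.
by move=> /pcard_leP/injfunPex.
Qed.

Lemma card_le_set_surj (t0 : T) A B : A #<= B -> exists f : U -> T, set_surj B A f.
Proof.
elim/Ppointed: T t0 A => [V v|V _ A]; first by have := no v.
by move=> /pcard_surjP.
Qed.

End Cardinality.

Lemma card_le_setX (T U V : Type) (v0 : V) (A : set T) (B : set U) :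
  [set: V * V] #<= [set: V] -> A #<= [set: V] -> B #<= [set: V] ->
  A `*` B #<= [set: V].
Proof.
move=> VV /(card_le_set_inj v0)[f _ f_inj] /(card_le_set_inj v0)[g _ g_inj].
apply: card_le_trans VV.
apply: (set_inj_card_le (f := fun p => (f p.1, g p.2))) => //.
move=> [x y] [x' y'] /set_mem[Ax By] /set_mem[Ax' By'] [fx gy].
by congr (_, _); [apply: f_inj fx|apply: g_inj gy]; exact: mem_set.
Qed.

Section WellOrder.
Variables (d : Order.disp_t) (I : orderType d).
Hypothesis I_wo : wochoice.well_order (<=%O : rel I).

Lemma well_order_min (A : set I) :
  A !=set0 -> exists2 m, A m & forall y, A y -> m <= y.
Proof.
move=> [x Ax]; have [|m [[]]] := @I_wo (mem A); first by exists x; rewrite inE.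
rewrite inE => Am m_min _; exists m => // y Ay.
by apply: m_min; rewrite inE.
Qed.

Lemma well_order_wf : well_founded (fun x y : I => x < y).
Proof.
move=> x; apply: contrapT => nx.
have [|m nm m_min] := @well_order_min [set y | ~ Acc (fun x y : I => x < y) y].
  by exists x.
by apply: nm; constructor => y; rewrite ltNge => /negP ym; apply: contrapT => /m_min.
Qed.

Lemma injective_choice (Y : Type) (U : I -> set Y) :
  (forall i, ~ (U i #<= below i)) ->
  exists2 g : I -> Y, (forall i, U i (g i)) & injective g.
Proof.
move=> U_large.
have fresh i (h : forall j, j < i -> Y) :
    exists2 y, U i y & forall j (ji : j < i), h j ji <> y.
  apply: contrapT => no_fresh; apply: (U_large i).
  pose hs (p : {j | j < i}) := let: exist j ji := p in h j ji.
  apply: (@card_le_trans _ _ _ [set: {j | j < i}]).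
    apply: card_le_trans (card_image_le hs _); apply: subset_card_le => y Uy.
    apply: contrapT => ny; apply: no_fresh; exists y => // j ji hj.
    by apply: ny; exists (exist _ j ji).
  by apply: (@set_inj_card_le _ _ _ _ sval) => [[]|p q _ _ /val_inj].
pose F i h := s2val (cid2 (fresh i h)).
pose g := Fix well_order_wf (fun=> Y) F.
have gE i : g i = F i (fun j _ => g j).
  apply: Fix_eq => {}i h h' hh'; congr (F i _).
  by apply: functional_extensionality_dep => j; apply: functional_extensionality_dep.
have g_fresh i j : j < i -> g j <> g i.
  by move=> ji; rewrite [g i]gE /F; case: cid2 => y /= _; exact.
exists g => [i|i j gij]; first by rewrite gE /F; case: cid2.
by apply/eqP; case: ltgtP => // /g_fresh; rewrite gij.
Qed.

End WellOrder.

Lemma well_order_lexi (d d' : Order.disp_t) (I : orderType d) (J : orderType d') :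
  wochoice.well_order (<=%O : rel I) -> wochoice.well_order (<=%O : rel J) ->
  wochoice.well_order (<=%O : rel (I *l J)).
Proof.
move=> I_wo J_wo A [p Ap].
have [|i [q Aq <-] i_min] := well_order_min I_wo (A := fst @` [set` A]).
  by exists p.1; exists p.
have [|j Aj j_min] := well_order_min J_wo (A := [set j | (q.1, j) \in A]).
  by exists q.2; rewrite /= -surjective_pairing.
have lb : wochoice.minimum_of (<=%O : rel (I *l J)) A (q.1, j).
  split=> // -[i' j'] A'; rewrite lexi_pair i_min /=; last by exists (i', j').
  apply/implyP => i'q; apply: j_min => /=.
  by have -> // : q.1 = i'; apply/le_anti; rewrite i'q i_min //; exists (i', j').
exists (q.1, j); split=> // r [Ar r_lb]; apply: le_anti.
by rewrite (proj2 lb) ?r_lb.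
Qed.

Section PartialFunctions.
Variables (d d' : Order.disp_t) (N : orderType d) (L : orderType d').
Implicit Types (t : pfun N L) (f g : N -> L) (a : N) (v : L).

Definition agree_below f g a : Prop := forall x, x < a -> f x = g x.

Definition pfill t v : N -> L :=
  fun x => if pselect (x < pdom t) is left xt then pval (exist _ x xt) else v.

Lemma pfill_extends t v : extended_by t (pfill t v).
Proof.
move=> [x xt]; rewrite /pfill /=; case: pselect => // xt'.
by rewrite (bool_irrelevance xt xt').
Qed.

Lemma pfill_out t v x : pdom t <= x -> pfill t v x = v.
Proof. by rewrite /pfill leNgt => /negP tx; case: pselect. Qed.

Lemma pfill_prestrict f a v : agree_below (pfill (prestrict f a) v) f a.
Proof. by move=> x xa; rewrite /pfill /=; case: pselect. Qed.

Lemma prestrictP f g a : prestrict f a = prestrict g a <-> agree_below f g a.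
Proof.
split=> [fg x xa|fg].
  by rewrite -(pfill_prestrict f (f x) xa) fg pfill_prestrict.
rewrite /prestrict; f_equal; apply: functional_extensionality_dep => -[x xa].
exact: fg.
Qed.

Lemma extended_byP t f : extended_by t f <-> t = prestrict f (pdom t).
Proof.
split=> [|->]; last by move=> x.
case: t => a w tf; rewrite /prestrict /=; f_equal.
by apply: functional_extensionality_dep => x; exact: tf.
Qed.

Lemma extended_by_prestrict f g a :
  extended_by (prestrict f a) g <-> agree_below f g a.
Proof. by split=> [fg x xa|fg [x xa]]; [exact: (fg (exist _ x xa))|exact: fg]. Qed.

Lemma extended_by_agree t f g :
  extended_by t f -> agree_below f g (pdom t) -> extended_by t g.
Proof. by move=> tf fg [x xt]; rewrite tf /= fg. Qed.

Lemma extended_by_agree_below t f g :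
  extended_by t f -> extended_by t g -> agree_below f g (pdom t).
Proof. by move=> tf tg x xt; rewrite -(tf (exist _ x xt)) (tg (exist _ x xt)). Qed.

Lemma pextended_by_prestrict t f a :
  pdom t <= a -> extended_by t f -> pextended_by t (prestrict f a).
Proof.
move=> ta tf [x xt]; have xa : x < a := lt_le_trans xt ta.
by exists (exist _ x xa) => //=; rewrite tf.
Qed.

End PartialFunctions.

Section Small.
Variables (d : Order.disp_t) (L : orderType d).

Definition small (I : Type) (A : set I) : Prop := ~ ([set: L] #<= A).

Lemma small_card_le (I J : Type) (A : set I) (B : set J) :
  A #<= B -> small B -> small A.
Proof. by move=> AB B_small LA; apply: B_small; exact: card_le_trans AB. Qed.

Lemma small_image (I J : Type) (A : set I) (f : I -> J) : small A -> small (f @` A).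
Proof. by apply: small_card_le; exact: card_image_le. Qed.

Lemma finite_small (I : Type) (A : set I) :
  infinite_set [set: L] -> finite_set A -> small A.
Proof. by move=> L_inf A_fin /card_le_finite/(_ A_fin). Qed.

Lemma regular_bounded (I : Type) (A : set I) (f : I -> L) :
  is_regular L -> small A -> exists x, forall i, A i -> f i < x.
Proof.
move=> [_ L_reg] /(small_image (f := f)) fA; apply: contrapT => nx; apply: fA.
apply: L_reg => x; apply: contrapT => nc; apply: nx; exists x => i Ai.
by rewrite ltNge; apply/negP => xi; apply: nc; exists (f i) => //; exists i.
Qed.

Lemma regular_bounded2 (I J : Type) (A : set I) (B : set J) (f : I -> J -> L) :
  is_regular L -> small A -> small B ->
  exists x, forall i j, A i -> B j -> f i j < x.
Proof.
move=> L_reg A_small B_small.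
have /choice[g gP] i := regular_bounded (f i) L_reg B_small.
have [x xP] := regular_bounded g L_reg A_small.
by exists x => i j Ai Bj; apply: lt_trans (xP i Ai); exact: gP.
Qed.

Lemma cardinal_well_order :
  is_infinite_cardinal L -> wochoice.well_order (<=%O : rel L).
Proof. by case=> -[]. Qed.

Lemma cardinal_infinite : is_infinite_cardinal L -> infinite_set [set: L].
Proof. by case. Qed.

Lemma cardinal_inhabited : is_infinite_cardinal L -> inhabited L.
Proof. by move=> /cardinal_infinite/infinite_setN0[x _]. Qed.

Lemma small_below (a : L) : is_infinite_cardinal L -> small (below a).
Proof. by case=> -[_ /(_ a)[]]. Qed.

Definition regular_cardinal : Prop := is_infinite_cardinal L /\ is_regular L.

Definition regular_uncountable : Prop := regular_cardinal /\ small [set: nat].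

Lemma regular_no_max (x : L) : regular_cardinal -> exists y, x < y.
Proof.
move=> [/cardinal_infinite L_inf L_reg].
have x_small : small [set x] by exact: finite_small (finite_set1 x).
by have [y /(_ x erefl) xy] := regular_bounded id L_reg x_small; exists y.
Qed.

Lemma small_le (a : L) : regular_cardinal -> small [set x | x <= a].
Proof.
move=> L_reg; have [b ab] := regular_no_max a L_reg.
apply: (small_card_le _ (@small_below b L_reg.1)).
by apply: subset_card_le => x /= xa; exact: le_lt_trans xa ab.
Qed.

Lemma not_unbounded (A : set L) : ~ unbounded A -> exists x, forall y, A y -> y <= x.
Proof.
move=> nA; apply: contrapT => nx; apply: nA => x; apply: contrapT => ny.
by apply: nx; exists x => y Ay; rewrite leNgt; apply/negP => xy; apply: ny; exists y.
Qed.

Lemma cofinal_unbounded (A : set L) : regular_cardinal -> cofinal A -> unbounded A.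
Proof.
move=> L_reg A_cof x; have [y xy] := regular_no_max x L_reg.
by have [z Az yz] := A_cof y; exists z => //; exact: lt_le_trans yz.
Qed.

Lemma unbounded_card_ge (A : set L) : is_regular L -> unbounded A -> [set: L] #<= A.
Proof.
by move=> [_ L_reg] A_unb; apply: L_reg => x; have [y Ay /ltW] := A_unb x; exists y.
Qed.

Lemma unbounded_card_eq (A : set L) :
  regular_cardinal -> unbounded A <-> A #= [set: L].
Proof.
move=> L_reg; split=> [A_unb|]; rewrite card_eq_le.
  by rewrite card_leT unbounded_card_ge //; exact: L_reg.2.
move=> /andP[_ LA]; apply: contrapT => /not_unbounded[x xP].
by apply: (small_le (a := x) L_reg); apply: card_le_trans LA (subset_card_le xP).
Qed.

Lemma unbounded_fiber (J : Type) (A : set L) (f : L -> J) :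
  is_regular L -> small [set: J] -> unbounded A ->
  exists i, unbounded (A `&` f @^-1` [set i]).
Proof.
move=> L_reg J_small A_unb; apply: contrapT => nu.
have /choice[b bP] i : exists x, forall y, (A `&` f @^-1` [set i]) y -> y <= x.
  by apply: not_unbounded => ub; apply: nu; exists i.
have [x xP] := regular_bounded b L_reg J_small; have [y Ay xy] := A_unb x.
have := lt_le_trans xy (bP (f y) y (conj Ay erefl)).
by rewrite ltNge ltW // xP.
Qed.

End Small.
Arguments small {d} L {I}.

Section StationarySets.
Variables (d : Order.disp_t) (K : orderType d).
Hypothesis K_reg : regular_uncountable K.
Implicit Types (W : set K) (F : K -> K) (a x y : K).

Definition closed_under F : set K :=
  [set a | limit_ordinal a /\ forall x, x < a -> F x < a].

Lemma sequence_sup (s : nat -> K) : (forall n, s n < s n.+1) ->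
  exists a, [/\ limit_ordinal a, forall n, s n < a &
    forall x, x < a -> exists n, x < s n].
Proof.
move=> s_incr; have [x xP] := regular_bounded s K_reg.1.2 K_reg.2.
have K_wo := cardinal_well_order K_reg.1.1.
have [|a sa a_min] := well_order_min K_wo (A := [set a | forall n, s n < a]).
  by exists x => n; exact: xP.
have a_sup y : y < a -> exists n, y < s n.
  move=> ya; apply: contrapT => ny; suff : a <= y by rewrite leNgt ya.
  apply: a_min => n; apply: lt_le_trans (s_incr n) _.
  by rewrite leNgt; apply/negP => yn; apply: ny; exists n.+1.
exists a; split=> //; split=> [|y /a_sup[n yn]]; first by exists (s 0%N).
by exists (s n).
Qed.

Lemma unbounded_closed_under F : unbounded (closed_under F).
Proof.
move=> x0.
have /choice[G GP] x : exists z, x < z /\ forall y, y <= x -> F y < z.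
  have [z zP] := regular_bounded F K_reg.1.2 (small_le (a := x) K_reg.1).
  have [z' xz'] := regular_no_max x K_reg.1.
  exists (Order.max z z'); split; first by rewrite lt_max xz' orbT.
  by move=> y yx; rewrite lt_max zP.
have [|a [a_lim sa a_sup]] := @sequence_sup (fun n => iter n G x0).
  by move=> n; case: (GP (iter n G x0)).
exists a; last exact: (sa 0%N).
split=> // x /a_sup[n /ltW xn]; apply: lt_trans (sa n.+1).
by have [_] := GP (iter n G x0); apply.
Qed.

Lemma closed_under_club F : is_club (closed_under F).
Proof.
split=> [|a a_lim [_ a_sup]]; first exact: unbounded_closed_under.
split=> // x xa; apply: contrapT => Fx; suff : a <= x by rewrite leNgt xa.
apply: a_sup => y [[_ yF] ya]; rewrite leNgt; apply/negP => xy; apply: Fx.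
exact: lt_trans (yF x xy) ya.
Qed.

Lemma stationaryP W : stationary W <-> forall F, exists2 a, W a & closed_under F a.
Proof.
split=> [W_st F|W_st C [C_unb C_cl]].
  by have [a [Wa aF]] := W_st _ (closed_under_club F); exists a.
have /choice[F FP] x : exists y, C y /\ x < y.
  by have [y Cy xy] := C_unb x; exists y.
have [a Wa [a_lim aF]] := W_st F; exists a; split=> //.
apply: C_cl => //; split=> [y [_ /ltW]//|z zP].
rewrite leNgt; apply/negP => za; have [CF zF] := FP z.
by have := zP (F z) (conj CF (aF _ za)); rewrite leNgt zF.
Qed.

Lemma not_stationary W :
  ~ stationary W -> exists F, forall a, W a -> ~ closed_under F a.
Proof.
move=> nW; apply: contrapT => nF; apply: nW; apply/stationaryP => F.
by apply: contrapT => na; apply: nF; exists F => a Wa aF; apply: na; exists a.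
Qed.

Lemma stationary_sub W W' : W `<=` W' -> stationary W -> stationary W'.
Proof. by move=> WW' W_st C /W_st[a [/WW' ? ?]]; exists a. Qed.

Lemma stationary_closed_under W F :
  stationary W -> stationary (W `&` closed_under F).
Proof.
move=> /stationaryP W_st; apply/stationaryP => G.
have [a Wa [a_lim aFG]] := W_st (fun x => Order.max (F x) (G x)).
by exists a; [split=> //|]; split=> // x /aFG; rewrite gt_max => /andP[].
Qed.

Lemma stationary_gt W x : stationary W -> stationary (W `&` [set a | x < a]).
Proof.
move=> /(stationary_closed_under (fun=> x)).
by apply: stationary_sub => a [Wa [[[y ya] _] /(_ y ya)]].
Qed.

Lemma stationary_unbounded W : stationary W -> unbounded W.
Proof.
by move=> /stationary_gt + x => /(_ x)/stationaryP/(_ id)[a [Wa xa] _]; exists a.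
Qed.

Lemma stationary_avoid (J : Type) (I : set J) W (B : J -> set K) :
  small K I -> stationary W -> (forall j, I j -> ~ stationary (B j)) ->
  stationary (W `\` \bigcup_(j in I) B j).
Proof.
move=> I_small W_st B_nst.
have [F FP] := set_choice id (fun j Ij => not_stationary (B_nst j Ij)).
have /choice[G GP] x := regular_bounded (F ^~ x) K_reg.1.2 I_small.
apply: stationary_sub (stationary_closed_under G W_st) => a [Wa [a_lim aG]].
split=> // -[j Ij Bja]; apply: (FP j Ij a Bja); split=> // x xa.
exact: lt_trans (GP _ _ Ij) (aG _ xa).
Qed.

Lemma stationary_fiber (J : Type) (I : set J) W (P : K -> J -> Prop) :
  small K I -> stationary W -> (forall a, W a -> exists2 j, I j & P a j) ->
  exists2 j, I j & stationary (W `&` P ^~ j).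
Proof.
move=> I_small W_st WP; apply: contrapT => nj.
have avoid_st := @stationary_avoid J I W (fun j => W `&` P ^~ j) I_small W_st _.
have [j Ij Wj|a [Wa na] _] := (stationaryP _).1 (avoid_st _) id.
  by apply: nj; exists j.
by have [j Ij Paj] := WP a Wa; apply: na; exists j.
Qed.

Lemma fodor W (P : K -> K -> Prop) :
  stationary W -> (forall a, W a -> exists2 x, x < a & P a x) ->
  exists x, stationary (W `&` P ^~ x).
Proof.
move=> W_st WP; apply: contrapT => nx.
have /choice[F FP] x : exists F, forall a, (W `&` P ^~ x) a -> ~ closed_under F a.
  by apply: not_stationary => st; apply: nx; exists x.
have le_small x := small_le (a := x) K_reg.1.
have /choice[G GP] x := regular_bounded2 F K_reg.1.2 (le_small x) (le_small x).
have [a Wa [a_lim aG]] := (stationaryP W).1 W_st G.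
have [x xa Pax] := WP a Wa; apply: (FP x a (conj Wa Pax)); split=> // y ya.
apply: lt_trans (aG (Order.max x y) _); last by rewrite gt_max xa.
by apply: GP; rewrite /= le_max lexx ?orbT.
Qed.

Definition stationary_fibers (V : Type) W (f : K -> V) : Prop :=
  forall v, stationary (W `&` f @^-1` [set v]).

Lemma stationary_fibers_comp (U V : Type) W (f : K -> U) (g : U -> V) :
  set_surj setT setT g -> stationary_fibers W f -> stationary_fibers W (g \o f).
Proof.
move=> g_surj fW v; have [u _ <-] := g_surj v I.
by apply: stationary_sub (fW u) => a [Wa /= ->].
Qed.

Lemma stationary_fibers_pair (U V : Type) W (f : K -> U) (g : U -> K -> V) :
  (forall u, stationary_fibers (W `&` f @^-1` [set u]) (g u)) ->
  stationary_fibers W (fun a => (f a, g (f a) a)).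
Proof.
move=> gW [u v]; apply: stationary_sub (gW u v) => a [[Wa fa] ga].
by split=> //=; rewrite fa ga.
Qed.

Lemma stationary_fibers_paste (V : Type) (v0 : V) (S : set (set K)) :
  trivIset S id -> (forall X, S X -> exists f : K -> V, stationary_fibers X f) ->
  exists f : K -> V, forall X, S X -> stationary_fibers X f.
Proof.
move=> S_triv S_fib.
have [f fP] := set_choice (fun=> v0) S_fib.
have [a [Y SY Ya]|X XP] := set_choice set0
    (A := \bigcup_(Y in S) Y) (P := fun a X => S X /\ X a); first by exists Y.
exists (fun a => f (X a) a) => Y SY v.
apply: stationary_sub (fP Y SY v) => a [Ya fa]; split=> //=.
have [SX Xa] : S (X a) /\ X a a by apply: XP; exists Y.
by have -> : X a = Y by apply: S_triv => //; exists a.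
Qed.

End StationarySets.

Section Tails.
Variables (d : Order.disp_t) (K : orderType d).
Implicit Types (A B : set K) (a x : K).

Definition tails a : set_system K :=
  filter_from (below a) (fun x => [set b | x <= b < a]).

Definition almost_disjoint a A B : Prop := \forall b \near tails a, ~ (A b /\ B b).

Lemma tails_itv a x : x < a -> \forall b \near tails a, x <= b < a.
Proof. by move=> xa; exists x. Qed.

Lemma almost_disjointC a A B : almost_disjoint a A B -> almost_disjoint a B A.
Proof. by move=> [x xa xP]; exists x => // b /xP nb [? ?]; exact: nb. Qed.

Lemma almost_disjoint_setU a A B X :
  almost_disjoint a X A -> almost_disjoint a X B -> almost_disjoint a X (A `|` B).
Proof.
move=> [x xa xP] [y ya yP]; exists (Order.max x y) => [|b].
  by rewrite /below /= gt_max xa.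
rewrite /= ge_max -andbA => /and3P[xb yb ba] [Xb [Ab|Bb]].
  by apply: (xP b); rewrite //= xb.
by apply: (yP b); rewrite //= yb.
Qed.

Lemma not_cofinal_below a A : A `<=` below a -> ~ cofinal_below A a ->
  \forall b \near tails a, ~ A b.
Proof.
move=> Aa nA; apply: contrapT => nt; apply: nA; split=> // x xa.
apply: contrapT => nb; apply: nt; exists x => // b /andP[xb ba] Ab.
by apply: nb; exists b.
Qed.

Lemma cofinal_below_nonempty a A : limit_ordinal a -> cofinal_below A a -> A !=set0.
Proof. by move=> [[x xa] _] [_ /(_ x xa)[b Ab _]]; exists b. Qed.

Lemma cofinal_below_sub a A B :
  A `<=` B -> B `<=` below a -> cofinal_below A a -> cofinal_below B a.
Proof. by move=> AB Ba [_ A_cof]; split=> // x /A_cof[b /AB]; exists b. Qed.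

Lemma cofinal_below_supremums a A :
  limit_ordinal a -> cofinal_below A a -> supremums A a.
Proof.
move=> [_ a_lim] [Aa A_cof]; split=> [y /Aa/ltW//|x xP].
rewrite leNgt; apply/negP => /a_lim[y xy /A_cof[b Ab yb]].
by have := lt_le_trans xy (le_trans yb (xP b Ab)); rewrite ltxx.
Qed.

Lemma supremums_lt a A x : wochoice.well_order (<=%O : rel K) ->
  x < a -> ubound A x -> exists2 s, supremums A s & s < a.
Proof.
move=> K_wo xa xP.
have [|s sP s_min] := well_order_min K_wo (A := ubound A); first by exists x.
by exists s => //; apply: le_lt_trans xa; exact: s_min.
Qed.

End Tails.

Section Cofinality.
Variables (d d' : Order.disp_t) (L : orderType d) (K : orderType d').
Implicit Types (a x : K).

Definition diverges a (f : K -> L) : Prop :=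
  forall m, \forall b \near tails a, m < f b.

Definition initially_injective (e : K -> K -> L) : Prop :=
  forall a, set_inj [set x | x <= a] (e a).

Lemma cofinality_bounded a (I : Type) (A : set I) (f : I -> K) :
  E_cof L K a -> small L A -> (forall i, A i -> f i < a) ->
  exists2 x, x < a & forall i, A i -> f i < x.
Proof.
move=> [_ a_cof] /(small_image (f := f)) fA fa; apply: contrapT => nx; apply: fA.
apply: a_cof; split=> [_ [i Ai <-]|x xa]; first exact: fa.
apply: contrapT => nc; apply: nx; exists x => // i Ai.
by rewrite ltNge; apply/negP => xi; apply: nc; exists (f i) => //; exists i.
Qed.

Lemma E_cof_limit a : infinite_set [set: L] -> E_cof L K a -> limit_ordinal a.
Proof.
move=> L_inf aE; split=> [|x xa].
  have none_small : small L (@set0 L) by exact: finite_small.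
  by have [//|x xa _] := cofinality_bounded (f := fun=> a) aE none_small; exists x.
have x_small : small L [set x] by exact: finite_small (finite_set1 x).
have [_ ->//|y ya xy] := cofinality_bounded (f := id) aE x_small.
by exists y => //; exact: xy.
Qed.

Lemma tails_filter a : infinite_set [set: L] -> E_cof L K a -> Filter (tails a).
Proof.
move=> L_inf /(E_cof_limit L_inf)[[x xa] _].
apply: filter_from_filter; first by exists x.
move=> y z ya za; exists (Order.max y z); first by rewrite /below /= gt_max ya.
by move=> b /=; rewrite ge_max -andbA => /and3P[-> -> ->].
Qed.

Lemma tails_bigcap a (I : Type) (A : set I) (P : I -> set K) :
  E_cof L K a -> small L A -> (forall i, A i -> tails a (P i)) ->
  tails a (\bigcap_(i in A) P i).
Proof.
move=> aE A_small AP.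
have [i /AP[x xa xP]|x xP] := set_choice a (A := A)
    (P := fun i x => x < a /\ forall b, x <= b < a -> P i b); first by exists x.
have [i /xP[]//|y ya yP] := cofinality_bounded (f := x) aE A_small.
exists y => // b /andP[yb ba] i Ai; have [_] := xP i Ai; apply.
by rewrite (le_trans (ltW (yP i Ai)) yb).
Qed.

Lemma tails_not_small a A : E_cof L K a -> small L (A `&` below a) ->
  \forall b \near tails a, ~ A b.
Proof.
move=> aE A_small; have [b [_]//|x xa xP] := cofinality_bounded (f := id) aE A_small.
exists x => // b /andP[xb ba] Ab.
by have := xP b (conj Ab ba); rewrite ltNge xb.
Qed.

Lemma almost_disjoint_bigcup a (I : Type) (A : set I) (X : set K) (P : I -> set K) :
  E_cof L K a -> small L A -> (forall i, A i -> almost_disjoint a X (P i)) ->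
  almost_disjoint a X (\bigcup_(i in A) P i).
Proof.
move=> aE A_small AP; have [x xa xP] := tails_bigcap aE A_small AP.
by exists x => // b /xP nb [Xb [i Ai Pb]]; apply: (nb i Ai).
Qed.

Lemma cofinal_enum a : infinite_set [set: L] -> E_cof L K a ->
  exists l : L -> K, cofinal_below (range l) a.
Proof.
move=> L_inf aE; have [[A A_cof +] _] := aE.
rewrite card_eq_le => /andP[/pfcard_geP AL _].
case: AL => [A0|/surjfunPex[l A_l]]; last by exists l; rewrite -A_l.
by have [x] := cofinal_below_nonempty (E_cof_limit L_inf aE) A_cof; rewrite A0.
Qed.

Lemma first_above a (l : L -> K) x : wochoice.well_order (<=%O : rel L) ->
  cofinal_below (range l) a -> x < a ->
  exists2 n, x <= l n & forall m, m < n -> l m < x.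
Proof.
move=> L_wo [_ l_cof] /l_cof[_ [n _ <-] xn].
have [|k xk k_min] := well_order_min L_wo (A := [set n | x <= l n]).
  by exists n.
by exists k => // m mk; rewrite ltNge; apply/negP => /k_min; rewrite leNgt mk.
Qed.

Lemma injection_diverges a (f : K -> L) : regular_cardinal L ->
  E_cof L K a -> set_inj (below a) f -> diverges a f.
Proof.
move=> L_reg aE f_inj m.
have [|x xa xP] := @tails_not_small a [set b | f b <= m] aE.
  apply: small_card_le (small_le (a := m) L_reg).
  apply: (set_inj_card_le (f := f)) => [b []//|b b'].
  by rewrite !inE => -[_ ba] [_ b'a]; apply: f_inj; rewrite inE.
by exists x => // b /xP /negP; rewrite -ltNge.
Qed.

Lemma diverges_bound a (f : K -> L) (y : L -> L) n :
  regular_cardinal L -> diverges a f ->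
  \forall b \near tails a, forall m, m <= n -> y m < f b.
Proof.
move=> L_reg f_div.
have [k kP] := regular_bounded y L_reg.2 (small_le (a := n) L_reg).
have [x xa xP] := f_div k; exists x => // b /xP kb m mn.
exact: lt_trans (kP m mn) kb.
Qed.

End Cofinality.

Section Ladders.
Variables (d d' : Order.disp_t) (L : orderType d) (K : orderType d').
Hypothesis L_reg : regular_cardinal L.
Hypothesis L_sqr : [set: L * L] #<= [set: L].
Implicit Types (C : set K) (a x : K) (y z : L -> L).

Let L_inf : infinite_set [set: L] := cardinal_infinite L_reg.1.
Let L_wo : wochoice.well_order (<=%O : rel L) := cardinal_well_order L_reg.1.

Definition ladder C a : Prop :=
  cofinal_below C a /\ forall x, x < a -> small L (C `&` below x).

Lemma ladder_exists a : E_cof L K a -> exists C, ladder C a.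
Proof.
move=> aE; have [l la] := cofinal_enum L_inf aE.
pose records := [set n | forall m, m < n -> l m < l n].
exists (l @` records); split=> [|x xa].
  split=> [_ [n _ <-]|x /(first_above L_wo la)[n xn n_min]].
    by apply: la.1; exists n.
  by exists (l n) => //; exists n => // m /n_min /lt_le_trans; apply.
have [n xn _] := first_above L_wo la xa.
apply: small_card_le (small_image (f := l) (small_le (a := n) L_reg)).
apply: subset_card_le => _ [[m m_rec <-] mx]; exists m => //=.
rewrite leNgt; apply/negP => /m_rec/lt_trans/(_ mx).
by rewrite ltNge xn.
Qed.

Lemma ladder_sub C C' a : C' `<=` C -> ~ small L C' -> ladder C a -> ladder C' a.
Proof.
move=> C'C C'_large [[Ca _] C_small].
have C'_small x : x < a -> small L (C' `&` below x).
  by move=> /C_small; apply: small_card_le; apply: subset_card_le => b [/C'C].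
do 2!split=> //; first by move=> b /C'C/Ca.
move=> x /C'_small C'x; apply: contrapT => nb; apply: C'_large.
apply: small_card_le C'x; apply: subset_card_le => b C'b; split=> //.
by rewrite /below /= ltNge; apply/negP => xb; apply: nb; exists b.
Qed.

Lemma ladder_tails C a a' : E_cof L K a' -> a' < a -> ladder C a ->
  \forall b \near tails a', ~ C b.
Proof. by move=> a'E a'a [_ /(_ a' a'a)]; exact: tails_not_small. Qed.

Lemma ladder_split C a : E_cof L K a -> ladder C a -> exists D : L -> set K,
  [/\ trivIset setT D, forall j, D j `<=` C & forall j, cofinal_below (D j) a].
Proof.
move=> aE aC; have [k _] := cofinal_below_nonempty (E_cof_limit L_inf aE) aC.1.
have [f fC f_inj] : exists2 f : L * L -> K, set_fun setT C f & set_inj setT f.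
  by apply: (card_le_set_inj k); apply: card_le_trans L_sqr (aE.2 _ aC.1).
have injf p q : f p = f q -> p = q by apply: f_inj; rewrite inE.
exists (fun j => range (fun m => f (j, m))).
have DC j : range (fun m => f (j, m)) `<=` C by move=> _ [m _ <-]; exact: fC.
split=> // [j j' _ _ [_ [[m _ <-] [m' _ /injf[]]]]//|j].
apply: (ladder_sub (DC j) _ aC).1; apply.
apply: (set_inj_card_le (f := fun m => f (j, m))) => [m _|m m' _ _ /injf[]//].
by exists m.
Qed.

Variable c : L -> K -> L.

(* Only z can be a limit point of the functions c^~ b along C. *)
Definition clusters_only_at C z a : Prop := forall y, y <> z ->
  exists n, \forall b \near tails a, ~ (C b /\ agree_below (c^~ b) y n).

Lemma convergent_ladder a : E_cof L K a ->
  exists C z, ladder C a /\ clusters_only_at C z a.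
Proof.
move=> aE; have [C aC] := ladder_exists aE; have [l0] := cardinal_inhabited L_reg.1.
pose follow z n := C `&` [set b | agree_below (c^~ b) z n].
have [[z z_lim]|no_lim] :=
    pselect (exists z, forall n, cofinal_below (follow z n) a); last first.
  exists C, (fun=> l0); split=> // y _; apply: contrapT => y_lim; apply: no_lim.
  exists y => n; apply: contrapT => /not_cofinal_below yn; apply: y_lim; exists n.
  by apply: yn => b [/(aC.1.1)].
have [n follow_le|f fC f_inj] := injective_choice L_wo (U := follow z).
  apply: (small_below (a := n) L_reg.1).
  exact: card_le_trans (aE.2 _ (z_lim n)) follow_le.
exists (range f), z; split=> [|y yz].
  apply: ladder_sub aC; first by move=> _ [n _ <-]; exact: (fC n).1.
  by apply; apply: (set_inj_card_le (f := f)) => [n _|n m _ _ /f_inj//]; exists n.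
have /existsNP[k yzk] : ~ (y =1 z) by move/funext.
have [n kn] := regular_no_max k L_reg; exists n.
have [m _|x xa xP] := cofinality_bounded (f := f) aE (small_below (a := n) L_reg.1).
  exact: aC.1.1 (fC m).1.
exists x => // b /andP[xb _] [[m _ fm] ym]; apply: yzk.
rewrite -ym // -fm (fC m).2 //.
apply: lt_le_trans kn _; rewrite leNgt; apply/negP => /xP.
by rewrite fm ltNge xb.
Qed.

End Ladders.

Section Scales.
Variables (d d' : Order.disp_t) (L : orderType d) (K : orderType d').
Hypothesis L_reg : regular_cardinal L.
Variable e : K -> K -> L.
Implicit Types (W : set K) (a b t : K).

Let L_inf : infinite_set [set: L] := cardinal_infinite L_reg.1.
Let L_wo : wochoice.well_order (<=%O : rel L) := cardinal_well_order L_reg.1.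

(* At a point of cofinality L below a, E depends on a only through t < a and k,
   which pressing down can freeze. *)
Definition scale a (E : K -> L) : Prop :=
  diverges a E /\ forall a', E_cof L K a' -> a' < a -> exists t k,
    [/\ a' <= t, t < a & \forall b \near tails a', E b = Order.max k (e t b)].

Lemma ladder_rank a : E_cof L K a -> exists (l : L -> K) (n : K -> L),
  [/\ forall m, l m < a, diverges a n &
      forall a', E_cof L K a' -> a' < a ->
        exists2 k, a' <= l k & \forall b \near tails a', n b = k].
Proof.
move=> aE; have [l la] := cofinal_enum L_inf aE.
have [l0] := cardinal_inhabited L_reg.1.
have la' m : l m < a by apply: la.1; exists m.
have [b ba|n nP] := set_choice l0 (A := below a)
    (P := fun b n => b < l n /\ forall m, m < n -> l m <= b).
  have [_ /(_ b ba)[y b_y /la.2[_ [k _ <-] yk]]] := E_cof_limit L_inf aE.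
  have [|m bm m_min] := well_order_min L_wo (A := [set m | b < l m]).
    by exists k; exact: lt_le_trans b_y yk.
  exists m; split=> // i im; rewrite leNgt; apply/negP => /m_min.
  by rewrite leNgt im.
exists l, n; split=> // [m|a' a'E a'a].
  have [//|x xa xP] := cofinality_bounded (f := l) aE (small_le (a := m) L_reg).
  exists x => // b /andP[xb ba]; rewrite ltNge; apply/negP => /xP nb.
  by have := lt_le_trans (lt_trans (nP b ba).1 nb) xb; rewrite ltxx.
have [k a'k /(cofinality_bounded a'E (small_below L_reg.1))[x xa' xP]] :=
  first_above L_wo la a'a.
exists k => //; exists x => // b /andP[xb ba'].
have [bl nb] := nP b (lt_trans ba' a'a).
apply/eqP; case: ltgtP => // [/xP nx|/nb kb].
  by have := lt_le_trans (lt_trans bl nx) xb; rewrite ltxx.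
by have := lt_le_trans ba' (le_trans a'k kb); rewrite ltxx.
Qed.

Lemma scale_exists a : E_cof L K a -> exists E, scale a E.
Proof.
move=> aE; have [l [n [la n_div n_const]]] := ladder_rank aE.
exists (fun b => Order.max (n b) (e (l (n b)) b)); split=> [m|a' a'E a'a].
  have a_filter := tails_filter L_inf aE; apply: filterS (n_div m) => b mn.
  by rewrite lt_max mn.
have [k a'k nk] := n_const a' a'E a'a; exists (l k), k; split=> //.
by have a'_filter := tails_filter L_inf a'E; apply: filterS nk => b ->.
Qed.

Hypothesis e_inj : initially_injective e.

Lemma scale_diverges a a' (E : K -> L) :
  scale a E -> E_cof L K a' -> a' <= a -> diverges a' E.
Proof.
move=> [E_div E_coh] a'E; rewrite le_eqVlt => /orP[/eqP ->//|a'a] m.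
have [t [k [a't _ Ek]]] := E_coh a' a'E a'a.
have et_inj : set_inj (below a') (e t).
  move=> b b'; rewrite !inE => ba' b'a'; apply: e_inj; rewrite inE.
    exact: le_trans (ltW ba') a't.
  exact: le_trans (ltW b'a') a't.
have a'_filter := tails_filter L_inf a'E.
apply: filterS2 Ek (injection_diverges L_reg a'E et_inj m) => b -> m_e.
by rewrite lt_max m_e orbT.
Qed.

Hypotheses (K_reg : regular_uncountable K) (L_small : small K [set: L]).

Lemma scale_freeze (E : K -> K -> L) W a' :
  (forall a, E_cof L K a -> scale a (E a)) -> stationary W -> W `<=` E_cof L K ->
  E_cof L K a' ->
  exists h : K -> L, exists2 x, x < a' &
    stationary [set a | W a /\ forall b, x <= b < a' -> E a b = h b].
Proof.
move=> E_scale W_st WE a'E.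
pose frozen a t k x := forall b, x <= b < a' -> E a b = Order.max k (e t b).
have [a [Wa a'a]|t t_frozen] := @fodor _ K K_reg _
    (fun a t => exists k x, x < a' /\ frozen a t k x)
    (stationary_gt K_reg a' W_st).
  have [_ /(_ a' a'E a'a)[t [k [_ ta [x xa' xP]]]]] := E_scale a (WE a Wa).
  by exists t => //; exists k, x.
have [a [_ [k [x kx]]]|k _ k_frozen] := @stationary_fiber _ K K_reg _ setT _
    (fun a k => exists x, x < a' /\ frozen a t k x) L_small t_frozen.
  by exists k => //; exists x.
have [a [_ [x [xa' xP]]]|x xa' x_frozen] :=
    @stationary_fiber _ K K_reg _ (below a') _
    (fun a x => frozen a t k x) (small_below K_reg.1.1) k_frozen.
  by exists x.
exists (fun b => Order.max k (e t b)), x => //.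
by apply: stationary_sub x_frozen => a [[[[]]]].
Qed.

End Scales.

Section NearSets.
Variables (d d' : Order.disp_t) (L : orderType d) (K : orderType d').
Hypothesis L_reg : regular_cardinal L.
Variable c : L -> K -> L.
Implicit Types (a b : K) (f : K -> L) (y z : L -> L).

Let L_inf : infinite_set [set: L] := cardinal_infinite L_reg.1.

Definition near_set f y : set K :=
  [set b | exists n, [/\ agree_below (c^~ b) y n, c n b <> y n & f b <= y n]].

(* Past a point where y and z differ, c^~ b cannot follow both, so b leaves one of
   them early, and then f b or g b is bounded. *)
Lemma near_set_disjoint a f g y z : E_cof L K a -> diverges a f -> diverges a g ->
  y <> z -> almost_disjoint a (near_set f y) (near_set g z).
Proof.
move=> /(tails_filter L_inf) a_filter f_div g_div yz.
have /existsNP[n yzn] : ~ (y =1 z) by move/funext.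
apply: filterS2 (diverges_bound y n L_reg f_div) (diverges_bound z n L_reg g_div).
move=> b fb gb [[i [yi _ fi]] [j [zj _ gj]]].
case: (leP i n) => [/fb|ni]; first by rewrite ltNge fi.
case: (leP j n) => [/gb|nj]; first by rewrite ltNge gj.
by apply: yzn; rewrite -yi // -zj.
Qed.

Lemma near_set_cluster a f y z (C : set K) : E_cof L K a -> diverges a f ->
  clusters_only_at c C z a -> y <> z -> almost_disjoint a (near_set f y) C.
Proof.
move=> /(tails_filter L_inf) a_filter f_div C_cluster /C_cluster[n Cn].
apply: filterS2 (diverges_bound y n L_reg f_div) Cn.
move=> b fb nCb [[i [yi _ fi]] Cb].
case: (leP i n) => [/fb|ni]; first by rewrite ltNge fi.
by apply: nCb; split=> // x xn; apply: yi; exact: lt_trans ni.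
Qed.

End NearSets.

Section SuccessorCardinal.
Variables (d d' : Order.disp_t) (L : orderType d) (K : orderType d').
Hypotheses (L_card : is_infinite_cardinal L) (K_succ : is_succ_cardinal L K).
Hypothesis L_sqr : [set: L * L] #<= [set: L].

Lemma succ_card_le : [set: L] #<= [set: K].
Proof. by case: K_succ => _ []. Qed.

Lemma succ_small (I : Type) (A : set I) : A #<= [set: L] -> small K A.
Proof.
by move=> AL KA; case: K_succ => _ [_ nKL] _; apply: nKL; exact: card_le_trans AL.
Qed.

Lemma succ_infinite_cardinal : is_infinite_cardinal K.
Proof.
split; first by case: K_succ.
by move=> /(card_le_finite succ_card_le); exact: cardinal_infinite.
Qed.

Lemma succ_le_card_le (a : K) : [set x | x <= a] #<= [set: L].
Proof.
have below_L : below a #<= [set: L].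
  by case: K_succ => -[_ a_lt] _; apply; exact: a_lt.
have [l0] := cardinal_inhabited L_card.
have [f _ f_inj] := card_le_set_inj l0 below_L.
have [l1 /eqP l10] : exists l, l <> l0.
  apply: contrapT => nl; apply: (cardinal_infinite L_card).
  apply: sub_finite_set (finite_set1 l0) => l _.
  by apply: contrapT => ll0; apply: nl; exists l.
apply: card_le_trans L_sqr.
apply: (set_inj_card_le
  (f := fun x => if x == a then (l1, l0) else (l0, f x))) => // x y.
rewrite !inE /= => xa ya.
case: (eqVneq x a) => [->|xNa]; case: (eqVneq y a) => [->|yNa] // -[].
- by move/eqP; rewrite (negPf l10).
- by move/eqP; rewrite eq_sym (negPf l10).
- by apply: f_inj; rewrite inE /below /= lt_neqAle ?xNa ?yNa.
Qed.

Lemma succ_initially_injective : exists e : K -> K -> L, initially_injective e.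
Proof.
have [l0] := cardinal_inhabited L_card.
have /choice[e e_inj] (a : K) : exists f : K -> L, set_inj [set x | x <= a] f.
  by have [f _ f_inj] := card_le_set_inj l0 (succ_le_card_le a); exists f.
by exists e.
Qed.

Lemma succ_regular : is_regular K.
Proof.
split=> [|A A_cof]; first by exists setT => // x; exists x.
apply: contrapT => nKA; have AL : A #<= [set: L].
  by case: K_succ => _ _; apply; split=> //; exact: card_leT.
have /choice[g gP] x : exists y, A y /\ x <= y.
  by have [y] := A_cof x; exists y.
have [l0] := cardinal_inhabited L_card.
have [u _ u_inj] := card_le_set_inj l0 AL.
have [e e_inj] := succ_initially_injective.
apply: (succ_small L_sqr).
apply: (set_inj_card_le (f := fun x => (u (g x), e (g x) x))) => // x y _ _ [ug].
have gxy : g x = g y by apply: u_inj ug; rewrite inE; apply: (gP _).1.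
rewrite gxy; apply: (e_inj (g y)); rewrite inE /=; last exact: (gP y).2.
by rewrite -gxy; exact: (gP x).2.
Qed.

Lemma succ_regular_uncountable : regular_uncountable K.
Proof.
split; first by split; [exact: succ_infinite_cardinal|exact: succ_regular].
by apply: succ_small; apply/infiniteP; exact: cardinal_infinite.
Qed.

Let K_reg : regular_uncountable K := succ_regular_uncountable.

(* Ulam's matrix: for some l, the sets {a in W | e a x = l} with x < a are
   stationary for K many x, and they are disjoint as e a is injective. *)
Lemma ulam W : stationary W -> exists f : K -> K, stationary_fibers W f.
Proof.
move=> W_st; have [e e_inj] := succ_initially_injective.
have [k] := cardinal_inhabited K_reg.1.1.
have L_small : small K [set: L] := succ_small (card_lexx _).
have /choice[level level_st] x : exists l,
    stationary (W `&` [set a | x < a] `&` [set a | e a x = l]).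
  have [a _|l _] := stationary_fiber K_reg (P := fun a l => e a x = l)
    L_small (stationary_gt K_reg x W_st); [by exists (e a x)|by exists l].
have [l l_unb] : exists l, unbounded (setT `&` level @^-1` [set l]).
  apply: unbounded_fiber K_reg.1.2 L_small _ => x.
  by have [y] := regular_no_max x K_reg.1; exists y.
have [r rP] := card_le_set_surj k (unbounded_card_ge K_reg.1.2 l_unb).
have [a [x xa]|h hP] := set_choice k (A := [set a | exists x, x < a /\ e a x = l])
    (P := fun a x => x < a /\ e a x = l); first by exists x.
exists (r \o h) => v; have [x [_ lx] <-] := rP v I.
apply: stationary_sub (level_st x) => a [[Wa xa] ex]; split=> //=.
have [ha eh] : h a < a /\ e a (h a) = l by apply: hP; exists x; rewrite ex lx.
by congr r; apply: (e_inj a); rewrite ?inE /= ?ltW // eh ex lx.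
Qed.

Lemma stationary_fibers_exist (V : Type) (v0 : V) W :
  [set: V] #<= [set: K * K] -> stationary W ->
  exists f : K -> V, stationary_fibers W f.
Proof.
move=> /(card_le_set_surj v0)[r r_surj] /ulam[f fW].
have /choice[g gW] v := ulam (fW v).
exists (r \o (fun a => (f a, g (f a) a))); apply: stationary_fibers_comp => //.
exact: stationary_fibers_pair.
Qed.

Lemma pfun_succ_card_le :
  [set: pfun L L] #<= [set: L] -> [set: pfun L K] #<= [set: K * K].
Proof.
move=> L_pow; have [l0] := cardinal_inhabited L_card.
have [k] := cardinal_inhabited K_reg.1.1.
have [r r_surj] :=
  card_le_set_surj (prestrict id l0) (card_le_trans L_pow succ_card_le).
have /choice[dec dec_surj] a := card_le_set_surj k (succ_le_card_le a).
apply: card_le_trans (card_image_le (fun p => prestrict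
  (fun l => dec p.1 (pfill (r p.2) l0 l)) (pdom (r p.2))) _).
apply: subset_card_le => s _; have L_small := succ_small (card_lexx [set: L]).
have [a aP] := regular_bounded (pfill s k) K_reg.1.2 L_small.
have /choice[m mP] l : exists l', dec a l' = pfill s k l.
  by have [l' _] := dec_surj a _ (ltW (aP l I)); exists l'.
have [v _ rv] := r_surj (prestrict m (pdom s)) I.
exists (a, v) => //; rewrite /= rv [RHS]((extended_byP s _).1 (pfill_extends k)).
by apply/prestrictP => l /= ls; rewrite pfill_prestrict.
Qed.

Lemma stationary_fibers_pfun (S : set (set K)) : [set: pfun L L] #<= [set: L] ->
  trivIset S id -> (forall X, S X -> stationary X) ->
  exists t : K -> pfun L K, forall X, S X -> stationary_fibers X t.
Proof.
move=> L_pow S_triv S_st; have [l0] := cardinal_inhabited L_card.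
have [k] := cardinal_inhabited K_reg.1.1; pose s0 := prestrict (fun=> k) l0.
apply: (stationary_fibers_paste s0) => // X /S_st.
exact: (stationary_fibers_exist s0 (pfun_succ_card_le L_pow)).
Qed.

End SuccessorCardinal.

Lemma pfun_sqr_card_le (d d' : Order.disp_t) (N : orderType d) (L : orderType d')
    (x y z : N) :
  x < y < z -> [set: L * L] #<= [set: pfun N L].
Proof.
move=> /andP[xy yz].
apply: (set_inj_card_le
  (f := fun p => prestrict (fun n => if n == x then p.1 else p.2) z)) => //.
move=> [u v] [u' v'] _ _ /prestrictP uv; congr (_, _).
  by have /= := uv x (lt_trans xy yz); rewrite eqxx.
by have /= := uv y yz; rewrite gt_eqF.
Qed.

Section Colorings.
Variables (dN dK dL : Order.disp_t).
Variables (N : orderType dN) (K : orderType dK) (L : orderType dL).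
Hypotheses (K_reg : regular_cardinal K) (pfun_small : small K [set: pfun N L]).
Variable c : N -> K -> L.
Implicit Types (s t : pfun N L) (Z B : set K) (T : set (pfun N L)).

Definition cone Z t : set K := Z `&` [set b | extended_by t (c^~ b)].

Definition limit_tree Z : set (pfun N L) := [set t | unbounded (cone Z t)].

Lemma limit_tree_tail Z :
  exists x, forall b t, Z b -> x < b -> extended_by t (c^~ b) -> limit_tree Z t.
Proof.
have [k] := cardinal_inhabited K_reg.1.
have /choice[x xP] t : exists x, limit_tree Z t \/ forall b, cone Z t b -> b <= x.
  have [t_unb|/not_unbounded[x xP]] := pselect (limit_tree Z t).
    by exists k; left.
  by exists x; right.
have [y yP] := regular_bounded x K_reg.2 pfun_small.
exists y => b t Zb yb tb; have [//|/(_ b (conj Zb tb))] := xP t.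
by rewrite leNgt (lt_trans (yP t I) yb).
Qed.

Lemma limit_tree_large Z : unbounded Z -> large_trees c (limit_tree Z).
Proof.
move=> Z_unb x; have [y yP] := limit_tree_tail Z.
have [b Zb] := Z_unb (Order.max x y); rewrite gt_max => /andP[xb yb].
by exists b => // a; apply: (yP b _ Zb yb); apply/extended_by_prestrict.
Qed.

Lemma limit_tree_realized Z T : T `<=` limit_tree Z -> exists F : K -> K,
  forall x t, T t -> exists b, cone Z t b /\ x <= b < F x.
Proof.
move=> TZ; suff /choice[F FP] x : exists y, forall t, T t ->
    exists b, cone Z t b /\ x <= b < y by exists F.
have [t /TZ/(_ x)[b tb xb]|b bP] := set_choice x (A := T)
    (P := fun t b => cone Z t b /\ x < b); first by exists b.
have [y yP] := regular_bounded b K_reg.2 pfun_small.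
by exists y => t /bP[tb xb]; exists (b t); rewrite ltW ?yP.
Qed.

Lemma tight_enum : tight c -> exists r : K -> set (pfun N L),
  (forall k, large_trees c (r k)) /\
  forall T, large_trees c T -> exists k, r k `<=` T.
Proof.
move=> [D [D_large D_dense /pfcard_geP DK]].
have /D_dense[T0 DT0 _] : large_trees c setT.
  by move=> x; have [y] := regular_no_max x K_reg; exists y.
case: DK => [D0|/surjfunPex[r Dr]]; first by move: DT0; rewrite D0.
exists r; split=> [k|T /D_dense[T' + T'T]].
  by apply: D_large; rewrite Dr; exists k.
by rewrite Dr => -[k _ rk]; exists k; rewrite rk.
Qed.

Lemma strongly_unbounded_fiber (f : N -> L) : strongly_unbounded c ->
  exists x, forall b, c^~ b = f -> b <= x.
Proof.
move=> c_unb; apply: not_unbounded => f_unb.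
have /c_unb[t /(_ (f (pdom t)))] : cofinal [set b | c^~ b = f].
  by move=> x; have [b fb /ltW xb] := f_unb x; exists b.
by move=> [_ [b [<- _] <-]]; rewrite ltxx.
Qed.

Lemma strongly_unbounded_image (B : set K) : strongly_unbounded c -> unbounded B ->
  ~ small K ((fun b => c^~ b) @` B).
Proof.
move=> c_unb B_unb B_small.
have /choice[x xP] f := strongly_unbounded_fiber f c_unb.
have [y yP] := regular_bounded x K_reg.2 B_small; have [b Bb yb] := B_unb y.
have := lt_le_trans yb (xP (c^~ b) b erefl).
by rewrite ltNge ltW // yP //; exists b.
Qed.

Definition luzin_coloring : Prop := forall B, unbounded B ->
  exists t, forall t', pextended_by t t' -> exists2 b, B b & extended_by t' (c^~ b).

Lemma luzin_agree B : luzin_coloring -> unbounded B ->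
  exists t, forall f a, pdom t <= a -> extended_by t f ->
  exists2 b, B b & agree_below f (c^~ b) a.
Proof.
move=> c_luzin /c_luzin[t t_dense]; exists t => f a ta tf.
have [b Bb /extended_by_prestrict] := t_dense _ (pextended_by_prestrict ta tf).
by exists b.
Qed.

Lemma luzin_strongly_unbounded : (forall x : N, exists y, x < y) ->
  (forall x : L, exists y, x < y) -> luzin_coloring -> strongly_unbounded c.
Proof.
move=> N_gt L_gt c_luzin B /(cofinal_unbounded K_reg) B_unb.
have [t t_dense] := luzin_agree c_luzin B_unb; exists t => x.
have [v xv] := L_gt x; have [a ta] := N_gt (pdom t).
have [b Bb tb] := t_dense (pfill t v) a (ltW ta) (@pfill_extends _ _ _ _ t v).
exists v => //; exists b; last by rewrite -tb // pfill_out.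
split=> //; apply: extended_by_agree (@pfill_extends _ _ _ _ t v) _ => x' x't.
by rewrite tb // (lt_trans x't).
Qed.

Definition compatible t : set (pfun N L) :=
  [set s | exists2 f, extended_by t f & extended_by s f].

Lemma compatible_large t : unbounded (cone setT t) -> large_trees c (compatible t).
Proof.
move=> t_unb x; have [b [_ tb] xb] := t_unb x; exists b => // a.
by exists (c^~ b) => //; apply/extended_by_prestrict.
Qed.

Lemma luzin_compatible T : inhabited L -> luzin_coloring -> large_trees c T ->
  exists2 t, unbounded (cone setT t) & compatible t `<=` T.
Proof.
move=> [v] c_luzin T_large; have [x x_tail] := limit_tree_tail setT.
have [|t t_dense] := luzin_agree (B := branches c T `&` [set b | x < b]) c_luzin.
  move=> z; have [b Tb] := T_large (Order.max x z).
  by rewrite gt_max => /andP[xb zb]; exists b.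
exists t.
  have [b [Tb xb] tb] := t_dense _ _ (lexx _) (@pfill_extends _ _ _ _ t v).
  by apply: (x_tail b) => //; apply: extended_by_agree tb; exact: pfill_extends.
move=> s [f tf sf].
have [|b [Tb _] fb] := t_dense f (Order.max (pdom t) (pdom s)) _ tf.
  by rewrite le_max lexx.
suff -> : s = prestrict (c^~ b) (pdom s) by exact: Tb.
apply/extended_byP; apply: extended_by_agree sf _ => y ys.
by apply: fb; rewrite lt_max ys orbT.
Qed.

Lemma luzin_tight : inhabited L -> [set: pfun N L] #<= [set: K] ->
  luzin_coloring -> tight c.
Proof.
move=> L_inh pfun_K c_luzin.
exists (compatible @` [set t | unbounded (cone setT t)]).
split=> [_ [t t_unb <-]|T /(luzin_compatible L_inh c_luzin)[t t_unb tT]|].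
- exact: compatible_large.
- by exists (compatible t) => //; exists t.
- by apply: card_le_trans (card_image_le _ _) (card_le_trans (card_leT _) pfun_K).
Qed.

End Colorings.

Lemma luzin_enum (d d' : Order.disp_t) (L : orderType d) (K : orderType d')
    (X : set (L -> L)) :
  inhabited L -> regular_cardinal K -> is_luzin K X ->
  exists c : L -> K -> L, luzin_coloring c.
Proof.
move=> [l0] K_reg [XK X_luzin].
have KX : [set: K] #<= X by move: XK; rewrite card_eq_le => /andP[].
have [f fX f_inj] := card_le_set_inj (fun=> l0) KX.
exists (fun x b => f b x) => B B_unb; have [||t t_dense] := X_luzin (f @` B).
- by move=> _ [b _ <-]; exact: fX.
- apply: card_eq_trans (inj_card_eq _) ((unbounded_card_eq _ K_reg).1 B_unb).
  by move=> x y _ _; apply: f_inj; rewrite inE.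
by exists t => t' /t_dense[_ [b Bb <-]]; exists b.
Qed.

Section TightColoring.
Variables (d d' : Order.disp_t) (L : orderType d) (K : orderType d').
Hypotheses (L_reg : regular_cardinal L) (L_pow : [set: pfun L L] #<= [set: L]).
Hypotheses (L_sqr : [set: L * L] #<= [set: L]) (K_succ : is_succ_cardinal L K).
Variable c : L -> K -> L.
Hypothesis c_unb : strongly_unbounded c.
Implicit Types (W X Z : set K) (a b : K) (T : set (pfun L L)).

Let L_inf : infinite_set [set: L] := cardinal_infinite L_reg.1.
Let L_wo : wochoice.well_order (<=%O : rel L) := cardinal_well_order L_reg.1.
Let K_reg : regular_uncountable K := succ_regular_uncountable L_reg.1 K_succ L_sqr.
Let L_small : small K [set: L] := succ_small K_succ (card_lexx _).
Let pfun_small : small K [set: pfun L L] := succ_small K_succ L_pow.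

Lemma distinct_branches (dJ : Order.disp_t) (J : orderType dJ)
    (T : K -> J -> set (pfun L L)) (z : K -> L -> L) :
  wochoice.well_order (<=%O : rel J) -> [set: J] #<= [set: L] ->
  (forall a i, large_trees c (T a i)) ->
  exists g : K -> J -> K,
    (forall a i, [/\ a <= g a i, branches c (T a i) (g a i) &
       forall a', a' <= a -> c^~ (g a i) <> z a']) /\
    injective (fun p : K * J => c^~ (g p.1 p.2)).
Proof.
move=> J_wo J_L T_large.
have /choice[x xP] a : exists x,
    a <= x /\ forall b a', a' <= a -> c^~ b = z a' -> b <= x.
  have /choice[x xP] a' := strongly_unbounded_fiber (z a') c_unb.
  have [y yP] := regular_bounded x K_reg.1.2 (small_le (a := a) K_reg.1).
  exists (Order.max a y); split=> [|b a' a'a /xP bx]; first by rewrite le_max lexx.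
  by rewrite le_max; apply/orP; right; exact: le_trans bx (ltW (yP a' a'a)).
have KJ_wo := well_order_lexi (cardinal_well_order K_reg.1.1) J_wo.
pose Q (p : K *l J) := branches c (T p.1 p.2) `&` [set b | x p.1 < b].
have Q_unb p : unbounded (Q p).
  move=> w; have [b Tb] := T_large p.1 p.2 (Order.max w (x p.1)).
  by rewrite gt_max => /andP[wb xb]; exists b.
have [p Qp|y yQ y_inj] :=
    injective_choice KJ_wo (U := fun p => (fun b => c^~ b) @` Q p).
  apply: (strongly_unbounded_image K_reg.1 c_unb (Q_unb p)).
  apply: (succ_small K_succ); apply: card_le_trans Qp _.
  have p1_L := succ_le_card_le L_reg.1 K_succ L_sqr p.1.
  have [l0] := cardinal_inhabited L_reg.1.
  apply: card_le_trans (card_le_setX l0 L_sqr p1_L J_L).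
  apply: subset_card_le => -[a j]; rewrite /below /= ltEprodlexi => /andP[/= ap _].
  by split.
have /choice[g gP] (p : K * J) : exists b,
    [/\ branches c (T p.1 p.2) b, x p.1 < b & c^~ b = y p].
  by have [b [Tb xb] cb] := yQ p; exists b.
exists (fun a i => g (a, i)); split=> [a i|p q].
  have [Tg xg _] := gP (a, i); have [ax zx] := xP a; split=> //.
    exact: ltW (le_lt_trans ax xg).
  by move=> a' a'a /(zx _ _ a'a); rewrite leNgt xg.
rewrite -!surjective_pairing; have [_ _ ->] := gP p; have [_ _ ->] := gP q.
exact: y_inj.
Qed.

Variables (e E : K -> K -> L).
Hypothesis e_inj : initially_injective e.
Hypothesis E_scale : forall a, E_cof L K a -> scale e a (E a).

(* A point b of Z whose sequence follows a common initial segment of the branches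
   chosen on W lies in the near sets of those branches c^~ (g a) taking a value
   above c n b at the first place n after that segment. *)
Lemma near_set_hits W Z T (g : K -> K) :
  stationary W -> W `<=` E_cof L K ->
  (forall a, W a -> a <= g a /\ branches c T (g a)) -> T `<=` limit_tree c Z ->
  exists2 a, W a & ~ almost_disjoint a (near_set c (E a) (c^~ (g a))) Z.
Proof.
move=> W_st WE gP TZ; apply: contrapT => nW.
pose misses a x := forall b, x <= b < a -> ~ (near_set c (E a) (c^~ (g a)) b /\ Z b).
have [a Wa|x missing_st] := @fodor _ K K_reg W misses W_st.
  by apply: contrapT => hit; apply: nW; exists a.
have [F F_hits] := limit_tree_realized K_reg.1 pfun_small TZ.
have /(stationaryP K_reg)/(_ F)[a' [Wa' xa'] [_ F_a']] := stationary_gt K_reg x W_st.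
have [|h [x' x'a' /(stationary_gt K_reg a')]] :=
  scale_freeze (a' := a') K_reg L_small E_scale missing_st _ (WE _ Wa').
  by move=> a [/WE].
set V := (X in stationary X) => V_st; have VW a : V a -> W a by move=> [[[]]].
have /c_unb[s s_unb] : cofinal (g @` V).
  move=> w; have [a Va wa] := stationary_unbounded K_reg V_st w.
  by exists (g a); [exists a|exact: le_trans (ltW wa) (gP a (VW a Va)).1].
set n := pdom s in s_unb; have [m nm] := regular_no_max n L_reg.
have [_ [_ [[a0 Va0 <-] sa0] _] _] := s_unb n.
have [b [[Zb /extended_by_prestrict a0b] /andP[+ bF]]] :=
  F_hits (Order.max x x') _ ((gP a0 (VW a0 Va0)).2 m).
have ba' : b < a' by apply: lt_trans bF (F_a' _ _); rewrite gt_max xa'.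
have [_ [_ [[a [[[Wa missed] Eh] a'a] <-] sa] <-]] :=
  s_unb (Order.max (h b) (c n b)).
rewrite gt_max ge_max => /andP[hn cn] /andP[xb x'b].
apply: (missed b); first by rewrite xb (lt_trans ba').
split=> //; exists n; split; last by rewrite Eh ?x'b // ltW.
  move=> i i_n; rewrite -a0b; last exact: lt_trans nm.
  exact: extended_by_agree_below sa0 sa i i_n.
by move=> cE; move: cn; rewrite cE ltxx.
Qed.

Section Guesses.
Variables (t : K -> pfun L K) (g : K -> L * L -> K) (z : K -> L -> L).
Variables (C : K -> set K) (D : K -> L -> set K).
Hypothesis g_inj : injective (fun p : K * (L * L) => c^~ (g p.1 p.2)).
Hypothesis g_neq_z : forall a p a', a' <= a -> c^~ (g a p) <> z a'.
Hypothesis C_ladder : forall a, E_cof L K a -> ladder L (C a) a.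
Hypothesis C_cluster : forall a, E_cof L K a -> clusters_only_at c (C a) (z a) a.
Hypothesis D_triv : forall a, E_cof L K a -> trivIset setT (D a).
Hypothesis D_C : forall a j, E_cof L K a -> D a j `<=` C a.
Hypothesis D_cof : forall a j, E_cof L K a -> cofinal_below (D a j) a.

Definition near_branch a l j : set K := near_set c (E a) (c^~ (g a (l, j))).

Definition near_branches a j : set K :=
  \bigcup_(l in below (pdom (t a))) near_branch a l j.

(* The near sets are disjoint from each other and from C a only up to bounded sets;
   the ladder pieces D a j make every guess cofinal. *)
Definition guess a j : set K :=
  D a j `|` below a `&` (near_branches a j `\`
    (C a `|` \bigcup_(i in below j) near_branches a i)).

Lemma guess_below a j : E_cof L K a -> guess a j `<=` below a.
Proof. by move=> aE b [/(D_cof j aE).1|[]]. Qed.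

Lemma guess_cofinal a j : E_cof L K a -> cofinal_below (guess a j) a.
Proof.
move=> aE; apply: cofinal_below_sub (D_cof j aE); last exact: guess_below.
by move=> b; left.
Qed.

Lemma guess_trivIset a : E_cof L K a -> trivIset setT (guess a).
Proof.
move=> aE i j _ _ [b [ib jb]].
case: ib jb => [iD|[_ [iN ni]]] [jD|[_ [jN nj]]].
- by apply: (D_triv aE) => //; exists b.
- by case: nj; left; exact: D_C iD.
- by case: ni; left; exact: D_C jD.
- apply/eqP; case: ltgtP => // [ij|ji]; first by case: nj; right; exists i.
  by case: ni; right; exists j.
Qed.

Lemma near_branch_disjoint a a' l j j' : E_cof L K a -> E_cof L K a' -> a' <= a ->
  a <> a' \/ j <> j' -> almost_disjoint a' (near_branch a l j) (near_branches a' j').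
Proof.
move=> aE a'E a'a ne.
apply: (almost_disjoint_bigcup a'E (small_below L_reg.1)) => l' _.
have Ea_div := scale_diverges L_reg e_inj (E_scale aE) a'E a'a.
apply: (near_set_disjoint L_reg c a'E Ea_div (E_scale a'E).1).
by move=> /(@g_inj (a, (l, j)) (a', (l', j')))[aa' _ jj']; case: ne.
Qed.

Lemma near_branch_ladder a a' l j : E_cof L K a -> E_cof L K a' -> a' <= a ->
  almost_disjoint a' (near_branch a l j) (C a').
Proof.
move=> aE a'E a'a.
have Ea_div := scale_diverges L_reg e_inj (E_scale aE) a'E a'a.
apply: (near_set_cluster L_reg a'E Ea_div (C_cluster a'E)).
exact: g_neq_z.
Qed.

Lemma guess_almost_disjoint a a' j j' : E_cof L K a -> E_cof L K a' -> a' < a ->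
  almost_disjoint a' (guess a j) (guess a' j').
Proof.
move=> aE a'E a'a; have a'_filter := tails_filter L_inf a'E.
have near_disj :
    almost_disjoint a' (C a' `|` near_branches a' j') (near_branches a j).
  apply: (almost_disjoint_bigcup a'E (small_below L_reg.1)) => l _.
  apply/almost_disjointC/almost_disjoint_setU.
    exact: near_branch_ladder (ltW a'a).
  apply: near_branch_disjoint (ltW a'a) _ => //.
  by left=> aa'; move: a'a; rewrite aa' ltxx.
rewrite /almost_disjoint.
apply: filterS2 (ladder_tails a'E a'a (C_ladder aE)) near_disj.
move=> b nCb nN [[/(D_C aE)//|[_ [Nb _]]] gb]; apply: nN; split=> //.
by case: gb => [/(D_C a'E)|[_ []]]; [left|right].
Qed.

Lemma guess_hits a l j Z : E_cof L K a -> l < pdom (t a) ->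
  ~ almost_disjoint a (near_branch a l j) Z -> cofinal_below (guess a j `&` Z) a.
Proof.
move=> aE l_len hit; have a_filter := tails_filter L_inf aE.
have [[x xa] _] := E_cof_limit L_inf aE.
have removed_disj : almost_disjoint a (near_branch a l j)
    (C a `|` \bigcup_(i in below j) near_branches a i).
  apply: almost_disjoint_setU; first exact: near_branch_ladder.
  apply: (almost_disjoint_bigcup aE (small_below L_reg.1)) => i ij.
  apply: near_branch_disjoint => //.
  by right=> ji; move: ij; rewrite ji /below /= ltxx.
apply: contrapT => /not_cofinal_below missed; apply: hit.
have missZ : \forall b \near tails a, ~ (guess a j `&` Z) b.
  by apply: missed => b [/(guess_below aE)].
rewrite /almost_disjoint; apply: filterS3 missZ removed_disj (tails_itv xa).
move=> b nZ nR /andP[_ ba] [lb Zb]; apply: nZ; split=> //; right; split=> //.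
by split; [exists l|move=> Rb; exact: nR].
Qed.

Lemma stationary_guess_hits (r : K -> set (pfun L L)) (k0 : K) X (B : set (set K)) :
  (forall T, large_trees c T -> exists k, r k `<=` T) ->
  (forall a l j, a <= g a (l, j) /\
     branches c (r (pfill (t a) k0 l)) (g a (l, j))) ->
  X `<=` E_cof L K -> stationary_fibers X t ->
  (forall Z, B Z -> unbounded Z) -> B #<= [set: L] -> small L B ->
  stationary [set a | X a /\ forall j Z, B Z -> cofinal_below (guess a j `&` Z) a].
Proof.
move=> r_dense g_branch XE Xt B_unb BL B_small.
have [enumB enumB_surj] := card_le_set_surj set0 BL.
have [k kP] := set_choice k0
  (fun Z BZ => r_dense _ (limit_tree_large K_reg.1 pfun_small c (B_unb Z BZ))).
have [l0] := cardinal_inhabited L_reg.1.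
have [Z /enumB_surj[l _ Zl]|code codeP] := set_choice l0 (A := B)
    (P := fun Z l => enumB l = Z); first by exists l.
have [l1 code_lt] := regular_bounded code L_reg.2 B_small.
pose s := prestrict (k \o enumB) l1.
pose I := [set p : L * L | p.1 < l1 /\ B (enumB p.1)].
pose missed (p : L * L) := X `&` t @^-1` [set s] `&`
  [set a | almost_disjoint a (near_branch a p.1 p.2) (enumB p.1)].
have missed_nst p : I p -> ~ stationary (missed p).
  case: p => l j [/= ll1 BZ] missed_st.
  have missedE : missed (l, j) `<=` E_cof L K by move=> a [[/XE]].
  have [|a [_ a_missed] //] :=
    near_set_hits (g := fun a => g a (l, j)) missed_st missedE _ (kP _ BZ).
  move=> a [[_ ta] _]; have [ag] := g_branch a l j.
  by rewrite ta pfill_prestrict.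
have I_small : small K I.
  by apply: (succ_small K_succ); exact: card_le_trans (card_leT _) L_sqr.
apply: stationary_sub (stationary_avoid K_reg I_small (Xt s) missed_nst).
move=> a [[Xa ta] na]; split=> // j Z BZ.
have ZE : enumB (code Z) = Z by exact: codeP.
apply: (guess_hits (XE a Xa) (l := code Z)); first by rewrite ta; exact: code_lt.
move=> a_missed; apply: na; exists (code Z, j).
  by split; rewrite /= ?ZE ?code_lt.
by split; rewrite //= ZE.
Qed.

End Guesses.

End TightColoring.

Lemma club_ad_of_guesses (d d' : Order.disp_t) (L : orderType d) (K : orderType d')
    (S : set (set K)) (A : K -> L -> set K) :
  regular_cardinal L -> regular_cardinal K ->
  \bigcup_(X in S) X = E_cof L K ->
  (forall a, E_cof L K a -> trivIset setT (A a)) ->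
  (forall a j, E_cof L K a -> cofinal_below (A a j) a) ->
  (forall a a' j j', E_cof L K a -> E_cof L K a' -> a' < a ->
     almost_disjoint a' (A a j) (A a' j')) ->
  (forall B X, (forall Z, B Z -> unbounded Z) -> B #<= [set: L] -> small L B ->
     S X -> stationary [set a | X a /\
       forall j Z, B Z -> cofinal_below (A a j `&` Z) a]) ->
  club_ad S L L.
Proof.
move=> L_reg K_reg S_cover A_triv A_cof A_ad A_guess.
have SE X a : S X -> X a -> E_cof L K a by move=> SX Xa; rewrite -S_cover; exists X.
have a_limit a : E_cof L K a -> limit_ordinal a.
  exact: E_cof_limit (cardinal_infinite L_reg.1).
exists (fun a => range (A a)); split.
- move=> a; rewrite S_cover => aE a_lim; split.
  + exact: trivIset_image (A_triv a aE).
  + apply: inj_card_eq; apply: trivIset_inj (A_triv a aE) => j _.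
    exact: cofinal_below_nonempty a_lim (A_cof a j aE).
  + by move=> _ [j _ <-]; exact: A_cof.
- move=> B B_card [BL B_small] X SX.
  apply: stationary_sub (A_guess B X _ BL B_small SX) => [a [Xa a_guess]|Z /B_card].
    split=> // _ Z [j _ <-] BZ.
    exact: cofinal_below_supremums (a_limit a (SE X a SX Xa)) (a_guess j Z BZ).
  by move/(unbounded_card_eq _ K_reg).
move=> _ _ [X SX [a Xa [j _ <-]]] [X' SX' [a' Xa' [j' _ <-]]] AA'.
have aE := SE X a SX Xa; have a'E := SE X' a' SX' Xa'.
suff [x xa x_ub] : exists2 x, x < a & ubound (A a j `&` A a' j') x.
  have [s s_sup sa] := supremums_lt (cardinal_well_order K_reg.1) xa x_ub.
  exists s, a; split=> //.
  exact: cofinal_below_supremums (a_limit a aE) (A_cof a j aE).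
case: (ltgtP a a') => [aa'|a'a|aa'].
- have [x xa xP] := A_ad a' a j' j a'E aE aa'; exists x => // b [jb j'b].
  rewrite leNgt; apply/negP => xb; apply: (xP b) => //.
  by rewrite /= ltW //; exact: (A_cof a j aE).1.
- by exists a' => // b [_ /(A_cof a' j' a'E).1/ltW].
- rewrite -aa' in AA' *; have [[x xa] _] := a_limit a aE.
  exists x => // b jj'b; case: AA'.
  by have -> : j = j' by apply: (A_triv a aE) => //; exists b.
Qed.

Lemma tight_club_ad (d d' : Order.disp_t) (L : orderType d) (K : orderType d')
    (c : L -> K -> L) (S : set (set K)) :
  regular_cardinal L -> [set: pfun L L] #<= [set: L] -> [set: L * L] #<= [set: L] ->
  is_succ_cardinal L K -> tight c -> strongly_unbounded c ->
  partition S id (E_cof L K) -> (forall X, S X -> stationary X) -> club_ad S L L.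
Proof.
move=> L_reg L_pow L_sqr K_succ c_tight c_unb [S_cover S_triv _] S_st.
have K_reg := succ_regular_uncountable L_reg.1 K_succ L_sqr.
have [k0] := cardinal_inhabited K_reg.1.1; have [l0] := cardinal_inhabited L_reg.1.
have [r [r_large r_dense]] := tight_enum K_reg.1 c_tight.
have [t St] := stationary_fibers_pfun L_reg.1 K_succ L_sqr L_pow S_triv S_st.
have [e e_inj] := succ_initially_injective L_reg.1 K_succ L_sqr.
have [E E_scale] := set_choice (fun=> l0) (@scale_exists _ _ L K L_reg e).
have [C /(set_choice (fun=> l0))[z Cz]] :=
  set_choice set0 (@convergent_ladder _ _ L K L_reg c).
have [D DP] :=
  set_choice (fun=> set0) (fun a aE => ladder_split L_reg L_sqr aE (Cz a aE).1).
have L_wo := cardinal_well_order L_reg.1.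
have [g [gP g_inj]] := distinct_branches L_reg L_sqr K_succ c_unb z
  (well_order_lexi L_wo L_wo) L_sqr (fun a p => r_large (pfill (t a) k0 p.1)).
have g_neq_z a p a' : a' <= a -> c^~ (g a p) <> z a' by have [_ _] := gP a p; apply.
have C_ladder a (aE : E_cof L K a) := (Cz a aE).1.
have C_cluster a (aE : E_cof L K a) := (Cz a aE).2.
have D_triv a (aE : E_cof L K a) : trivIset setT (D a) by case: (DP a aE).
have D_C a j (aE : E_cof L K a) : D a j `<=` C a by case: (DP a aE).
have D_cof a j (aE : E_cof L K a) : cofinal_below (D a j) a by case: (DP a aE).
apply: (@club_ad_of_guesses _ _ L K S (guess c E t g C D) L_reg K_reg.1 S_cover).
- by move=> a aE; exact: guess_trivIset.
- by move=> a j aE; exact: guess_cofinal.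
- exact: (guess_almost_disjoint L_reg e_inj E_scale t g_inj g_neq_z
    C_ladder C_cluster D_C).
- move=> B X B_unb BL B_small SX.
  have XE : X `<=` E_cof L K by move=> a Xa; rewrite -S_cover; exists X.
  apply: (stationary_guess_hits (k0 := k0) L_reg L_pow L_sqr K_succ c_unb e_inj E_scale
    g_inj g_neq_z C_cluster D_cof r_dense _ XE (St X SX) B_unb BL B_small).
  by move=> a l j; have [ag gb _] := gP a (l, j).
Qed.

Theorem theoremA (d d' : Order.disp_t) (L : orderType d) (K : orderType d')
    (L_card : is_infinite_cardinal L) (L_reg : is_regular L)
    (L_pow : [set: L] #= [set: pfun L L])
    (K_succ : is_succ_cardinal L K) :
  ((exists X : set (L -> L), is_luzin K X) ->
   exists c : L -> K -> L, tight c /\ strongly_unbounded c)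
  /\
  ((exists c : L -> K -> L, tight c /\ strongly_unbounded c) ->
   forall S : set (set K),
     partition S id (E_cof L K) -> (forall X, S X -> stationary X) ->
     club_ad S L L).
Proof.
have L_rc : regular_cardinal L by [].
have L_gt x := regular_no_max x L_rc; have L_inh := cardinal_inhabited L_card.
have pfun_L : [set: pfun L L] #<= [set: L].
  by move: L_pow; rewrite card_eq_le => /andP[].
have L_sqr : [set: L * L] #<= [set: L].
  have [x] := L_inh; have [y xy] := L_gt x; have [z yz] := L_gt y.
  apply: card_le_trans pfun_L; apply: (@pfun_sqr_card_le _ _ _ _ x y z).
  by rewrite xy.
have [K_rc _] := succ_regular_uncountable L_card K_succ L_sqr.
have pfun_small := succ_small K_succ pfun_L.
split=> [[X]|[c [c_tight c_unb]] S]; last exact: tight_club_ad c_unb.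
move=> /(luzin_enum L_inh K_rc)[c c_luzin]; exists c; split.
  exact: luzin_tight (card_le_trans pfun_L (succ_card_le K_succ)) c_luzin.
exact: luzin_strongly_unbounded c_luzin.
Qed.
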